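(* Let $p\ge 1$ be real and $m\ge 1$ an integer. For any two probability measures $\mu,\nu$ on $\mathbb{X}$ with finite $p$-th moments, $$\left\Vert \mathbb{E}_{\Psi_\mu^m}[\lambda_X]-\mathbb{E}_{\Psi_\nu^m}[\lambda_Y]\right\Vert_\infty\le m^{1/p}\,W_{\rho,p}(\mu,\nu).$$
   Context: Setting. $(\mathbb{X},\rho)$ is a metric space, and $\mathcal{P}(\mathbb{X})$ denotes its Borel probability measures. $H$ denotes the Hausdorff distance between subsets of $\mathbb{X}$. Fix $T>0$, and let $\mathcal{D}_T$ be the set of persistence diagrams (finite multisets of points $(b,d)$ with $0\le b\le d\le T$), equipped with the bottleneck distance $d_b$. Diagrams of samples. For a finite point set $X=\{x_1,\dots,x_m\}\subset\mathbb{X}$, $D_X\in\mathcal{D}_T$ is the persistence diagram of a fixed filtration built on $X$ (e.g. the Vietoris–Rips filtration). The map $X\mapsto D_X$ is assumed measurable and to satisfy the stability property $d_b(D_X,D_Y)\le H(X,Y)$ for all finite $X,Y\subset\mathbb{X}$. Landscapes. For $D\in\mathcal{D}_T$, its landscape $\lambda_D:\mathbb{N}_{\ge1}\times\mathbb{R}\to\mathbb{R}$ is defined by letting $\lambda_D(k,t)$ be the $k$-th largest value of $\{\max(0,\min(t-b,d-t)) : (b,d)\in D\}$, with value $0$ if there are fewer than $k$ such values. Norms are $\|\lambda\|_\infty=\sup_{k,t}|\lambda(k,t)|$. Landscapes satisfy $\|\lambda_D-\lambda_{D'}\|_\infty\le d_b(D,D')$. Write $\lambda_X:=\lambda_{D_X}$.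 Push-forward measures. Let $\phi_m:\mathbb{X}^m\to\mathcal{D}_T$ be $\phi_m(x_1,\dots,x_m)=D_{\{x_1,\dots,x_m\}}$, and let $\psi(D)=\lambda_D$. For $\mu\in\mathcal{P}(\mathbb{X})$, set $\Phi^m_\mu=(\phi_m)_*\mu^{\otimes m}$ and $\Psi^m_\mu=(\psi\circ\phi_m)_*\mu^{\otimes m}$. Then $\mathbb{E}_{\Psi^m_\mu}[\lambda_X]$ is the pointwise expectation $(k,t)\mapsto\mathbb{E}[\lambda_X(k,t)]$, where $X$ is an i.i.d. sample of $m$ points from $\mu$. Wasserstein distance. $W_{\rho,p}(\mu,\nu)=\left(\inf_\Pi\int\rho(x,y)^p\,d\Pi(x,y)\right)^{1/p}$, where the infimum is over couplings $\Pi$ of $\mu$ and $\nu$. *)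

(* Defs.v *)
From HB Require Import structures.
From mathcomp Require Import all_boot all_order all_algebra.
From mathcomp Require Import all_classical all_reals all_analysis.
Set Implicit Arguments.
Unset Strict Implicit.
Unset Printing Implicit Defensive.
Import Order.TTheory GRing.Theory Num.Theory.
Import numFieldNormedType.Exports.
Local Open Scope classical_set_scope.
Local Open Scope ring_scope.

Section Defs.
Variable R : realType.

Definition is_metric (X : Type) (rho : X -> X -> R) : Prop :=
  [/\ forall x y, 0 <= rho x y,
      forall x y, rho x y = 0 <-> x = y,
      forall x y, rho x y = rho y x &
      forall x y z, rho x z <= rho x y + rho y z].

Definition rho_open (X : Type) (rho : X -> X -> R) : set (set X) :=
  [set A | forall x, A x -> exists2 r : R, 0 < r & [set y | rho x y < r] `<=` A].

(* Hausdorff distance between two finite (nonempty) point sets given as lists *)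
Definition hdist_pt (X : Type) (rho : X -> X -> R) (x : X) (s : seq X) : R :=
  \big[Num.min/rho x (head x s)]_(y <- s) rho x y.
Definition hausdorff (X : Type) (rho : X -> X -> R) (s s' : seq X) : R :=
  Num.max (\big[Num.max/0]_(x <- s) hdist_pt rho x s')
          (\big[Num.max/0]_(y <- s') hdist_pt rho y s).

(* a diagram is a finite multiset of points (b,d), represented by a list *)
Definition is_diagram (T : R) (D : seq (R * R)) : Prop :=
  forall bd, bd \in D -> 0 <= bd.1 /\ bd.1 <= bd.2 /\ bd.2 <= T.

Definition linf (p q : R * R) : R := Num.max `|p.1 - q.1| `|p.2 - q.2|.
Definition diag_cost (p : R * R) : R := (p.2 - p.1) / 2.

Definition partial_matching (D D' : seq (R * R))
    (f : {ffun 'I_(size D) -> option 'I_(size D')}) : Prop :=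
  forall i j k, f i = Some k -> f j = Some k -> i = j.

Definition matching_cost (D D' : seq (R * R))
    (f : {ffun 'I_(size D) -> option 'I_(size D')}) : R :=
  Num.max
    (\big[Num.max/0]_(i < size D)
        match f i with
        | Some j => linf (nth (0,0) D i) (nth (0,0) D' j)
        | None => diag_cost (nth (0,0) D i)
        end)
    (\big[Num.max/0]_(j < size D' | ~~ [exists i, f i == Some j])
        diag_cost (nth (0,0) D' j)).

Definition bottleneck (D D' : seq (R * R)) : R :=
  inf [set c | exists f, partial_matching f /\ c = @matching_cost D D' f].

(* landscape D k t = k-th largest value (k >= 1) of max(0, min(t-b, d-t)) *)
Definition landscape (D : seq (R * R)) (k : nat) (t : R) : R :=
  nth 0 (sort (fun x y : R => y <= x)
              [seq Num.max 0 (Num.min (t - bd.1) (bd.2 - t)) | bd <- D]) k.-1.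

Section Meas.
Context {d : measure_display} {X : measurableType d}.

Definition is_product_measure (m : nat) (mu : probability X R)
    (P : probability (m.-tuple X) R) : Prop :=
  forall A : 'I_m -> set X, (forall i, measurable (A i)) ->
    P [set x : m.-tuple X | forall i, A i (tnth x i)] = (\prod_(i < m) mu (A i))%E.

Definition finite_moment (rho : X -> X -> R) (p : R) (mu : probability X R) : Prop :=
  exists x0 : X, (\int[mu]_x ((rho x0 x) `^ p)%:E < +oo)%E.

Definition coupling (mu nu : probability X R) (Pi : probability (X * X)%type R) : Prop :=
  forall A, measurable A -> Pi (A `*` setT) = mu A /\ Pi (setT `*` A) = nu A.

Definition wasserstein (rho : X -> X -> R) (p : R) (mu nu : probability X R) : \bar R :=
  poweR (ereal_inf [set c | exists Pi : probability (X * X)%type R,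
            coupling mu nu Pi /\ c = (\int[Pi]_z ((rho z.1 z.2) `^ p)%:E)%E]) p^-1.
End Meas.
End Defs.

(* Main.v *)
Require Import Defs.
From HB Require Import structures.
From mathcomp Require Import all_boot all_order all_algebra.
From mathcomp Require Import all_classical all_reals all_analysis.
From mathcomp Require Import measurable_realfun lra zify.
Set Implicit Arguments.
Unset Strict Implicit.
Unset Printing Implicit Defensive.
Import Order.TTheory GRing.Theory Num.Theory.
Import numFieldNormedType.Exports.
Local Open Scope classical_set_scope.
Local Open Scope ring_scope.

(** Let [f x] be the value at [(k, t)] of the landscape of the diagram of the
    sample [x].  Landscapes are 1-Lipschitz for the bottleneck distance: a
    partial matching of cost [c] injects the points whose tent function at [t]
    is at least [v > c] into the points whose tent function is at least [v - c].
    With the stability of diagrams, [|f x - f y|] is then at most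
    [max_i rho (x_i) (y_i)].  Given a coupling [Pi] of [mu] and [nu], the product
    measure of [m] copies of [Pi] couples those of [mu] and [nu], so by Jensen
    [|E f x - E f y|^p <= E (sum_i rho (x_i) (y_i)^p) = m * E_Pi rho^p],
    and it remains to take the infimum over [Pi]. *)

(** * Order statistics of a list through counting *)

Lemma le_nth_sort_ge (R : realType) (s : seq R) (v : R) (n : nat) :
  (n < size s)%N ->
  (v <= nth 0 (sort (fun x y : R => y <= x) s) n) = (n < count (>= v) s)%N.
Proof.
set ge := fun x y : R => _.
have geT : total ge by move=> x y; rewrite /ge le_total.
have getr : transitive ge by move=> y x z xy yz; exact: le_trans yz xy.
rewrite -(count_sort ge) -(size_sort ge).
have := sort_sorted geT s; move: (sort ge s) => {}s srt ns.
have mono i j : (i <= j)%N -> (j < size s)%N -> nth 0 s j <= nth 0 s i.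
  move=> ij js; apply: (sorted_leq_nth getr _ 0 srt) => //.
  - by move=> x; exact: lexx.
  - by rewrite inE (leq_ltn_trans ij).
(* Cut the decreasing list at [n]. If [v] is at most entry [n], the whole prefix counts and entry
   [n] adds one more; otherwise nothing from entry [n] on counts, which leaves at most [n]. *)
rewrite -{2}(cat_take_drop n s) count_cat.
have cT (t : seq R) (P : pred R) :
    (forall i, (i < size t)%N -> P (nth 0 t i)) -> count P t = size t.
  by move=> H; apply/eqP; rewrite -all_count; apply/(all_nthP 0).
have cF (t : seq R) (P : pred R) :
    (forall i, (i < size t)%N -> ~~ P (nth 0 t i)) -> count P t = 0%N.
  move=> H; have : count (predC P) t = size t by exact: cT.
  by move=> /(congr1 (addn (count P t))); rewrite count_predC; lia.
have [vn|nv] := leP v (nth 0 s n); symmetry.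
  rewrite cT; last first.
    move=> i; rewrite size_takel ?(ltnW ns)// => it; rewrite nth_take//=.
    by apply: le_trans vn _; apply: mono => //; exact: ltnW.
  rewrite size_takel ?(ltnW ns)// -[ltnLHS]addn0 ltn_add2l -has_count.
  by rewrite (drop_nth 0 ns)/= vn.
rewrite [X in (_ + X)%N]cF ?addn0; last first.
  move=> i; rewrite size_drop => it; rewrite nth_drop/= -ltNge.
  by apply: le_lt_trans nv; apply: mono; [exact: leq_addr|lia].
apply/negbTE; rewrite -leqNgt (leq_trans (count_size _ _))//.
by rewrite size_take ns.
Qed.

Lemma count_ord (A : Type) (x0 : A) (P : pred A) (s : seq A) :
  count P s = #|[set i : 'I_(size s) | P (nth x0 s i)]%SET|.
Proof.
by rewrite -sum1_count (big_nth x0) big_mkord -sum1_card; apply: eq_bigl => i;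
  rewrite inE.
Qed.

(** Choosing a partner for each element of [A] gives an injection into [B]. A relation is used
    instead of a function so that a partial matching can be read in both directions. *)
Lemma leq_card_rel (I J : finType) (r : I -> J -> bool) (A : {set I})
    (B : {set J}) :
  (forall i i' j, r i j -> r i' j -> i = i') ->
  (forall i, i \in A -> exists2 j, j \in B & r i j) -> (#|A| <= #|B|)%N.
Proof.
move=> rinj rtot; pose f i := [pick j in B | r i j].
have fP i : i \in A -> exists2 j, f i = Some j & (j \in B) && r i j.
  move=> /rtot[j jB rij]; rewrite /f; case: pickP => [j' ?|/(_ j)]; first by exists j'.
  by rewrite jB rij.
have finj : {in A &, injective f}.
  move=> i i' /fP[j -> /andP[_ ij]] /fP[j' -> /andP[_ ij']] [jj'].
  by rewrite -jj' in ij'; exact: rinj ij ij'.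
rewrite -(card_in_imset finj) -(card_imset (mem B) (@Some_inj _)).
apply/subset_leq_card/fintype.subsetP => _ /imsetP[i /fP[j fij /andP[jB _]] ->].
by rewrite fij; exact: imset_f.
Qed.

(** More than [n] points of [s] reach the value [v] of rank [n]; their distinct partners reach
    [v - c], so rank [n] in [s'] does too. Only points with value above [c] need a partner, which
    leaves room for points matched to the diagonal. *)
Lemma nth_sort_ge_le_rel (R : realType) (A : Type) (x0 : A) (F : A -> R)
    (s s' : seq A) (r : 'I_(size s) -> 'I_(size s') -> bool) (c : R) (n : nat) :
  (forall x, 0 <= F x) -> 0 <= c ->
  (forall i i' j, r i j -> r i' j -> i = i') ->
  (forall i : 'I_(size s), c < F (nth x0 s i) ->
     exists2 j : 'I_(size s'), r i j & F (nth x0 s i) - c <= F (nth x0 s' j)) ->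
  nth 0 (sort (fun x y : R => y <= x) (map F s)) n <=
  nth 0 (sort (fun x y : R => y <= x) (map F s')) n + c.
Proof.
move=> F0 c0 rinj rtot; set v := (X in X <= _); set w := (X in X + c).
have w0 : 0 <= w.
  have [ns|ns] := ltnP n (size s'); last first.
    by rewrite /w nth_default// size_sort size_map.
  rewrite /w le_nth_sort_ge ?size_map// count_map (@eq_count _ _ predT) ?count_predT//.
(* If [v <= c], nonnegativity of [w] suffices. If [v > c], then [v] is positive, hence not the
   default 0, and [n] is a genuine index of [s]. *)
have [|cv] := leP v c; first lra.
have ns : (n < size s)%N.
  rewrite ltnNge; apply/negP => sn; move: cv.
  by rewrite /v nth_default ?size_sort ?size_map// ltNge c0.
have : (n < count (>= v) (map F s))%N by rewrite -le_nth_sort_ge ?size_map.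
rewrite count_map (count_ord x0) => nc.
have {nc} : (n < count (>= (v - c)%R) (map F s'))%N.
  rewrite (leq_trans nc)// count_map (count_ord x0).
  apply: (leq_card_rel rinj) => i; rewrite inE/= => vi.
  have [j rij ij] := rtot i (lt_le_trans cv vi).
  by exists j => //; rewrite inE/=; lra.
move=> nc; rewrite -lerBlDr le_nth_sort_ge//.
exact: leq_trans nc (count_size _ _).
Qed.

(** * Tent functions and the stability of landscapes *)

Definition tent (R : realType) (t : R) (bd : R * R) : R :=
  Num.max 0 (Num.min (t - bd.1) (bd.2 - t)).

Lemma tent_ge0 (R : realType) (t : R) bd : 0 <= tent t bd.
Proof. by rewrite /tent le_max lexx. Qed.

(** The tent peaks at the midpoint of [[b, d]]: the minimum of [t - b] and [d - t] is at most their
    average. *)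
Lemma tent_le_diag_cost (R : realType) (t : R) (bd : R * R) :
  bd.1 <= bd.2 -> tent t bd <= diag_cost bd.
Proof.
move=> h; rewrite /tent /diag_cost ge_max ge_min.
by apply/andP; split; [lra|apply/orP; case: (leP (t - bd.1) (bd.2 - t)) => ?; [left|right]; lra].
Qed.

(** Minimum and maximum are 1-Lipschitz for the sup norm; the proof checks every ordering of the
    arguments. *)
Lemma tent_linf (R : realType) (t : R) (p q : R * R) :
  tent t p - linf p q <= tent t q.
Proof.
rewrite /tent /linf; set M := Num.max `|_| _.
have M1 : p.1 - q.1 <= M /\ q.1 - p.1 <= M.
  by split; rewrite le_max; apply/orP; left; [|rewrite distrC]; exact: ler_norm.
have M2 : p.2 - q.2 <= M /\ q.2 - p.2 <= M.
  by split; rewrite le_max; apply/orP; right; [|rewrite distrC]; exact: ler_norm.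
case: (leP (t - p.1) (p.2 - t)) => ?; case: (leP (t - q.1) (q.2 - t)) => ?;
  case: (leP 0 _) => ?; case: (leP 0 _) => ?; lra.
Qed.

Lemma linfC (R : realType) (p q : R * R) : linf p q = linf q p.
Proof. by rewrite /linf distrC [in X in Num.max _ X]distrC. Qed.

Lemma landscapeE (R : realType) (D : seq (R * R)) k t :
  landscape D k t = nth 0 (sort (fun x y : R => y <= x) (map (tent t) D)) k.-1.
Proof. by []. Qed.

Section stability.
Variables (R : realType) (T : R) (D D' : seq (R * R)).
Hypotheses (Ddiag : is_diagram T D) (D'diag : is_diagram T D').
Variable f : {ffun 'I_(size D) -> option 'I_(size D')}.
Hypothesis fP : partial_matching f.

Let c := matching_cost f.

Let c_ge0 : 0 <= c.
Proof. by rewrite /c /matching_cost le_max bigmax_ge_id. Qed.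

Let matched i j : f i = Some j -> linf (nth (0, 0) D i) (nth (0, 0) D' j) <= c.
Proof.
move=> fij; rewrite /c /matching_cost le_max; apply/orP; left.
by apply: (bigmax_sup i) => //; rewrite fij.
Qed.

Let unmatchedl i : f i = None -> diag_cost (nth (0, 0) D i) <= c.
Proof.
move=> fi; rewrite /c /matching_cost le_max; apply/orP; left.
by apply: (bigmax_sup i) => //; rewrite fi.
Qed.

Let unmatchedr j : ~~ [exists i, f i == Some j] ->
  diag_cost (nth (0, 0) D' j) <= c.
Proof.
move=> fj; rewrite /c /matching_cost le_max; apply/orP; right.
exact: (bigmax_sup j).
Qed.

(** Each of the two inequalities uses the matching in one direction. Injectivity of the relation
    comes from [f] being a function in one case, and from [fP] in the other. *)
Lemma landscape_matching k t :
  `|landscape D k t - landscape D' k t| <= matching_cost f.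
Proof.
rewrite ler_distlC !landscapeE; apply/andP; split; last first.
  apply: (@nth_sort_ge_le_rel _ _ (0, 0) _ _ _ (fun j i => f i == Some j)) => //.
  - exact: tent_ge0.
  - by move=> j j' i /eqP-> /eqP[].
  - move=> j cj; have [/existsP[i /eqP fij]|nj] := boolP [exists i, f i == Some j].
      exists i; first exact/eqP.
      rewrite (le_trans _ (tent_linf t (nth (0, 0) D' j) _))//.
      by rewrite lerD2l lerN2 linfC matched.
    (* An unmatched point cannot occur here: its tent value is at most its diagonal cost, hence at
       most [c], against [cj]. *)
    have [_ [bd _]] := D'diag (mem_nth (0, 0) (ltn_ord j)).
    by move: (tent_le_diag_cost t bd) (unmatchedr nj) cj; rewrite -/c; lra.
rewrite lerBlDr.
apply: (@nth_sort_ge_le_rel _ _ (0, 0) _ _ _ (fun i j => f i == Some j)) => //.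
- exact: tent_ge0.
- by move=> i i' j /eqP + /eqP; exact: fP.
- move=> i ci; case fi : (f i) => [j|].
    exists j; first exact/eqP.
    rewrite (le_trans _ (tent_linf t (nth (0, 0) D i) _))//.
    by rewrite lerD2l lerN2 matched.
  have [_ [bd _]] := Ddiag (mem_nth (0, 0) (ltn_ord i)).
  by move: (tent_le_diag_cost t bd) (unmatchedl fi) ci; rewrite -/c; lra.
Qed.

End stability.

Lemma landscape_bottleneck (R : realType) (T : R) (D D' : seq (R * R)) k t :
  is_diagram T D -> is_diagram T D' ->
  `|landscape D k t - landscape D' k t| <= bottleneck D D'.
Proof.
move=> Dd D'd; apply: lb_le_inf.
  (* The empty matching, sending every point to the diagonal, makes the set of costs nonempty. *)
  exists (@matching_cost _ D D' [ffun=> None]), [ffun=> None]; split => //.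
  by move=> i j l; rewrite ffunE.
by move=> _ [f [fP ->]]; exact: (landscape_matching Dd D'd fP).
Qed.

(** This uniform bound will make landscape values integrable. Past the end of the list the default
    value 0 satisfies it as well. *)
Lemma landscape_itv (R : realType) (T : R) (D : seq (R * R)) k t : 0 <= T ->
  is_diagram T D -> 0 <= landscape D k t <= T.
Proof.
move=> T0 Dd; rewrite landscapeE; set s := sort _ _.
have [ks|ks] := ltnP k.-1 (size s); last by rewrite nth_default// lexx.
have : nth 0 s k.-1 \in s by exact: mem_nth.
rewrite mem_sort => /mapP[bd /Dd[b0 [bd12 dT]] ->]; rewrite tent_ge0/=.
by move: (tent_le_diag_cost t bd12); rewrite /diag_cost; lra.
Qed.

(** The point with the same index is a candidate for the nearest one, so it bounds the distance to
    the other sample. Both directions are assumed because [rho] is arbitrary here. *)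
Lemma hausdorff_tuple_le (R : realType) (X : Type) (rho : X -> X -> R) (m : nat)
    (x y : m.-tuple X) (c : R) : 0 <= c ->
  (forall i, rho (tnth x i) (tnth y i) <= c) ->
  (forall i, rho (tnth y i) (tnth x i) <= c) -> hausdorff rho x y <= c.
Proof.
move=> c0.
have H (u v : m.-tuple X) : (forall i, rho (tnth u i) (tnth v i) <= c) ->
    \big[Num.max/0]_(a <- u) hdist_pt rho a v <= c.
  move=> uv; rewrite big_tuple; apply: bigmax_le => // i _.
  by apply: le_trans (uv i); rewrite /hdist_pt big_tuple; exact: bigmin_le_cond.
by move=> xy yx; rewrite /hausdorff ge_max !H.
Qed.

(** * Product measures on tuples: uniqueness and existence *)

Section product_measure.
Context (R : realType) (d : measure_display) (X : measurableType d).

Definition box (m : nat) (A : 'I_m -> set X) : set (m.-tuple X) :=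
  [set x | forall i, A i (tnth x i)].

Lemma measurable_box (m : nat) (A : 'I_m -> set X) :
  (forall i, measurable (A i)) -> measurable (box A).
Proof.
move=> mA; have -> : box A = \bigcap_(i in [set: 'I_m]) ((@tnth m X)^~ i @^-1` A i).
  by apply/seteqP; split => [x xA i _|x xA i]; exact: xA.
apply: fin_bigcap_measurable => [|]; first exact: finite_finset.
move=> i _; rewrite -[X in measurable X]setTI.
exact: measurable_tnth.
Qed.

(** The preimage of a set under a projection is a box whose other sides are the whole space. Boxes
    are preferred as generators because they are stable under intersection, as uniqueness of
    measures requires. *)
Lemma tuple_measurable_box (m : nat) :
  (@measurable _ (m.-tuple X)) =
  <<s [set B | exists2 A : 'I_m -> set X,
        (forall i, measurable (A i)) & B = box A] >>.
Proof.
apply/seteqP; split; last first.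
  apply: smallest_sub; first exact: sigma_algebra_measurable.
  by move=> _ [A mA ->]; exact: measurable_box.
rewrite [X in X `<=` _]/measurable/=; apply: sub_smallest2r.
  exact: smallest_sigma_algebra.
move=> B; rewrite -bigcup_seq => -[i _ [A mA <-]].
exists (fun j => if j == i then A else setT); first by move=> j; case: ifP.
rewrite setTI; apply/seteqP; split => [x xA j|x /(_ i)]; last by rewrite eqxx.
by case: eqP => // ->.
Qed.

Lemma product_measure_uniq (m : nat) (mu : probability X R)
    (P Q : probability (m.-tuple X) R) :
  is_product_measure mu P -> is_product_measure mu Q ->
  forall A, measurable A -> P A = Q A.
Proof.
move=> muP muQ A mA; apply: (measure_unique _ (fun=> setT) (tuple_measurable_box m)) => //.
- move=> _ _ [A1 mA1 ->] [A2 mA2 ->]; exists (fun i => A1 i `&` A2 i).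
    by move=> i; exact: measurableI.
  by apply/seteqP; split=> [x [x1 x2] i|x x12]; split; try move=> i;
    first [exact: x1|exact: x2|have [] := x12 i].
- by move=> _; exists (fun=> setT) => //; apply/seteqP.
- by rewrite bigcup_const.
- by move=> _ [B mB ->]; exact: etrans (muP _ mB) (esym (muQ _ mB)).
- by move=> _; rewrite (le_lt_trans (probability_le1 _ _))// ltry.
Qed.

(** Needed for the product of [m] copies of a coupling. By induction: the Dirac mass at the empty
    tuple, then the image of [mu \x P] under [cons]. *)
Lemma product_measure_ex (m : nat) (mu : probability X R) :
  exists P : probability (m.-tuple X) R, is_product_measure mu P.
Proof.
elim: m => [|m [P muP]].
  exists (\d_[tuple] : probability _ R) => A mA.
  rewrite big_ord0 -(probability_setT (\d_[tuple] : probability (0.-tuple X) R)).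
  by congr dirac; apply/seteqP; split => // x _ [].
pose c (z : X * m.-tuple X) : m.+1.-tuple X := [the m.+1.-tuple X of z.1 :: z.2].
have mc : measurable_fun setT c by exact: measurable_cons.
pose C : {mfun (X * m.-tuple X)%type >-> (m.+1.-tuple X)} :=
  HB.pack c (isMeasurableFun.Build _ _ _ _ _ mc).
exists (distribution (mu \x P)%E C) => A mA.
rewrite /distribution /pushforward big_ord_recl/=.
rewrite -(muP (fun i => A (lift ord0 i)))//.
rewrite -(@product_measure1E _ _ _ _ _ mu P)//; last first.
  exact: (@measurable_box _ (fun i => A (lift ord0 i))).
congr (product_measure1 _ _ _); apply/seteqP; split => -[x y]/=.
  by move=> H; split; [exact: (H ord0)|move=> i; have := H (lift ord0 i); rewrite tnthS].
move=> [Ax Ay] i; case: (unliftP ord0 i) => [j ->|->]//.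
by rewrite tnthS; exact: Ay.
Qed.

End product_measure.

(** * Jensen's inequality for powers *)

Section moments.
Context (R : realType) (d : measure_display) (T : measurableType d).
Variable P : probability T R.
Local Open Scope ereal_scope.

(** This is Hölder's inequality against the constant 1, whose norm is 1 on a probability space. *)
Lemma probability_integral_powR (p : R) (h : T -> R) : (1 <= p)%R ->
  measurable_fun setT h -> (forall x, 0 <= h x)%R ->
  (\int[P]_x (h x)%:E) `^ p <= \int[P]_x ((h x) `^ p)%:E.
Proof.
move=> p1 mh h0; have p0 : (0 < p)%R by exact: lt_le_trans p1.
have E : 'N[P]_p%:E[EFin \o h] `^ p = \int[P]_x ((h x) `^ p)%:E.
  rewrite poweR_Lnorm ?gt_eqF//; apply: eq_integral => x _ /=.
  by rewrite ger0_norm.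
have E1 : 'N[P]_1[EFin \o h] = \int[P]_x (h x)%:E.
  by rewrite Lnorm1; apply: eq_integral => x _ /=; rewrite ger0_norm.
rewrite -E -E1; apply: gt0_ler_poweR; rewrite ?in_itv/= ?Lnorm_ge0 ?leey ?(ltW p0)//.
(* For [p = 1] the two norms coincide; this case is set apart because the conjugate exponent
   [p / (p - 1)] would have denominator 0. *)
move: p1; rewrite le_eqVlt => /predU1P[<-//|p1].
pose q := (p / (p - 1))%R.
have q0 : (0 < q)%R by rewrite divr_gt0// subr_gt0.
have pq : (p^-1 + q^-1 = 1)%R.
  by rewrite /q invf_div mulrBl mul1r divff ?gt_eqF// addrC subrK.
have := @hoelder _ _ _ P h (cst 1%R) p q mh (measurable_cst _) p0 q0 pq.
rewrite [X in _ * X](_ : _ = 1) ?mule1; last first.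
  transitivity ('N[P]_q%:E[cst 1]); first exact: eq_Lnorm.
  by rewrite Lnorm_cst1 -[RHS](poweR1r q^-1); congr (_ `^ _); exact: probability_setT.
by under [X in 'N[_]_1[X] <= _]eq_fun do rewrite /= mulr1.
Qed.

End moments.

(** * Images and marginals of product measures *)

Section product_measure_integral.
Context (R : realType) (dX dY : measure_display).
Context (X : measurableType dX) (Y : measurableType dY) (m : nat).
Variables (nu : probability Y R) (Q : probability (m.-tuple Y) R).
Hypothesis nuQ : is_product_measure nu Q.
Local Open Scope ereal_scope.

Lemma measurable_map_tuple (f : Y -> X) : measurable_fun setT f ->
  measurable_fun setT (fun y : m.-tuple Y => [tuple of map f y]).
Proof.
move=> mf; apply/measurable_fun_tnthP => i.
rewrite (_ : _ \o _ = f \o (@tnth m Y)^~ i).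
  by apply: measurableT_comp => //; exact: measurable_tnth.
by apply/funext => y /=; rewrite tnth_map.
Qed.

(** The image of [Q] under coordinatewise application of [f] has the product values on boxes, so by
    uniqueness it is [P]. With [f] a projection, this turns a product of couplings into a coupling
    of products. *)
Lemma ge0_integral_product_map (mu : probability X R)
    (P : probability (m.-tuple X) R) (f : Y -> X) (g : m.-tuple X -> \bar R) :
  is_product_measure mu P -> measurable_fun setT f ->
  (forall A, measurable A -> nu (f @^-1` A) = mu A) ->
  measurable_fun setT g -> (forall x, 0 <= g x) ->
  \int[P]_x g x = \int[Q]_y g [tuple of map f y].
Proof.
move=> muP mf numu mg g0; have mF := measurable_map_tuple mf.
pose F : {mfun (m.-tuple Y) >-> (m.-tuple X)} :=
  HB.pack (fun y : m.-tuple Y => [tuple of map f y])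
          (isMeasurableFun.Build _ _ _ _ _ mF).
rewrite -[RHS](@ge0_integral_distribution _ _ _ _ _ Q F g mg g0).
apply: eq_measure_integral => A mA _; apply: (product_measure_uniq muP) => // B mB.
rewrite /distribution /pushforward/=.
transitivity (\prod_(i < m) nu (f @^-1` B i)); last first.
  by apply: eq_bigr => i _; rewrite numu.
rewrite -nuQ; last first.
  by move=> i; rewrite -[X in measurable X]setTI; exact: mf.
by congr (Q _); apply/seteqP; split => y /= yB i; have := yB i; rewrite tnth_map.
Qed.

(** The marginal of [Q] at [i] is [nu]: evaluate [Q] on the box with side [A] at [i] and the whole
    space elsewhere. *)
Lemma ge0_integral_product_tnth (i : 'I_m) (g : Y -> \bar R) :
  measurable_fun setT g -> (forall y, 0 <= g y) ->
  \int[Q]_y g (tnth y i) = \int[nu]_y g y.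
Proof.
move=> mg g0.
pose F : {mfun (m.-tuple Y) >-> Y} :=
  HB.pack ((@tnth m Y)^~ i) (isMeasurableFun.Build _ _ _ _ _ (measurable_tnth i)).
rewrite -[LHS](@ge0_integral_distribution _ _ _ _ _ Q F g mg g0).
apply: eq_measure_integral => A mA _; rewrite /distribution /pushforward/=.
pose B j := if j == i then A else setT.
transitivity (\prod_(j < m) nu (B j)); last first.
  rewrite (bigD1 i)//= /B eqxx big1 ?mule1// => j /negbTE ->.
  exact: probability_setT.
rewrite -nuQ; last by move=> j; rewrite /B; case: ifP.
congr (Q _); apply/seteqP; split => [y yA j|y /(_ i)]; last by rewrite /B eqxx.
by rewrite /B; case: eqP => // ->.
Qed.

End product_measure_integral.

(** * From couplings to the Wasserstein bound *)

Section transport.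
Context (R : realType) (d : measure_display) (X : measurableType d).
Variables (rho : X -> X -> R) (p : R) (m : nat).
Hypothesis rho_ge0 : forall x y, 0 <= rho x y.
Hypothesis rho_meas : measurable_fun setT (fun z : X * X => rho z.1 z.2).
Hypothesis p_ge1 : 1 <= p.
Variables (f : m.-tuple X -> R) (M : R).
Hypothesis f_meas : measurable_fun setT f.
Hypothesis f_itv : forall x, 0 <= f x <= M.
Hypothesis f_lip : forall (x y : m.-tuple X) (c : R), 0 <= c ->
  (forall i, rho (tnth x i) (tnth y i) <= c) -> `|f x - f y| <= c.

Let p_gt0 : 0 < p. Proof. exact: lt_le_trans p_ge1. Qed.

Lemma lip_powR_le_sum (x y : m.-tuple X) :
  `|f x - f y| `^ p <= \sum_(i < m) rho (tnth x i) (tnth y i) `^ p.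
Proof.
set S := \sum_(i < m) _.
have S0 : 0 <= S by apply: sumr_ge0 => i _; exact: powR_ge0.
rewrite -[leRHS]powRr1// -(mulVf (lt0r_neq0 p_gt0)) powRrM.
apply: ge0_ler_powR; rewrite ?nnegrE ?powR_ge0 ?(ltW p_gt0)//.
(* The Lipschitz constant is taken as [c = S^(1/p)], which dominates each distance since its [p]-th
   power is one term of the nonnegative sum [S]. *)
apply: f_lip => [|i]; first exact: powR_ge0.
rewrite -[leLHS]powRr1// -(mulfV (lt0r_neq0 p_gt0)) powRrM.
apply: ge0_ler_powR; rewrite ?nnegrE ?invr_ge0 ?powR_ge0 ?(ltW p_gt0)//.
by rewrite /S (bigD1 i)//= lerDl; apply: sumr_ge0 => j _; exact: powR_ge0.
Qed.

Lemma product_coupling_le (mu nu : probability X R)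
    (P Q : probability (m.-tuple X) R) (Pi : probability (X * X)%type R) :
  is_product_measure mu P -> is_product_measure nu Q -> coupling mu nu Pi ->
  ((`|\int[P]_x f x - \int[Q]_y f y| `^ p)%:E <=
   m%:R%:E * \int[Pi]_z ((rho z.1 z.2) `^ p)%:E)%E.
Proof.
move=> muP nuQ muPinu; have [W PiW] := product_measure_ex m Pi.
pose fst_ (z : m.-tuple (X * X)) : m.-tuple X := [tuple of map fst z].
pose snd_ (z : m.-tuple (X * X)) : m.-tuple X := [tuple of map snd z].
have mfst : measurable_fun setT (f \o fst_).
  by apply: measurableT_comp => //; exact: measurable_map_tuple.
have msnd : measurable_fun setT (f \o snd_).
  by apply: measurableT_comp => //; exact: measurable_map_tuple.
have mEf : measurable_fun setT (EFin \o f) by exact/measurable_EFinP.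
have Ef0 x : (0 <= (EFin \o f) x)%E by rewrite lee_fin; case/andP: (f_itv x).
have PE : \int[P]_x f x = \int[W]_z (f \o fst_) z.
  congr fine; apply: (ge0_integral_product_map PiW muP _ _ mEf) => // A mA.
  by rewrite -[RHS](muPinu A mA).1; congr (Pi _); apply/seteqP; split => -[x y]//= -[].
have QE : \int[Q]_x f x = \int[W]_z (f \o snd_) z.
  congr fine; apply: (ge0_integral_product_map PiW nuQ _ _ mEf) => // A mA.
  by rewrite -[RHS](muPinu A mA).2; congr (Pi _); apply/seteqP; split => -[x y]//= -[].
have W1 : (W setT < +oo)%E by rewrite (le_lt_trans (probability_le1 _ _))// ltry.
(* Boundedness gives integrability under [W], so the difference of the two expectations becomes the
   expectation of a difference. *)
have bnd (h : m.-tuple (X * X) -> m.-tuple X) : [bounded (f \o h) x | x in setT].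
  exists M; split; first exact: num_real.
  move=> e Me z _ /=; have /andP[f0 fM] := f_itv (h z).
  by rewrite ger0_norm// (le_trans fM)// ltW.
have if1 : W.-integrable setT (EFin \o (f \o fst_)).
  exact: measurable_bounded_integrable.
have if2 : W.-integrable setT (EFin \o (f \o snd_)).
  exact: measurable_bounded_integrable.
pose h z := `|f (fst_ z) - f (snd_ z)|.
have mh : measurable_fun setT h.
  by apply: measurableT_comp => //; exact: measurable_funB.
have mrho i : measurable_fun setT
    (fun z : m.-tuple (X * X) => (rho (tnth z i).1 (tnth z i).2 `^ p)%:E).
  apply/measurable_EFinP; apply: (measurableT_comp (measurable_powR p)).
  exact: (measurableT_comp rho_meas (measurable_tnth i)).
rewrite PE QE -RintegralB// -poweR_EFin.
apply: (@le_trans _ _ (((\int[W]_z (h z)%:E) `^ p)%E)).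
  apply: gt0_ler_poweR; rewrite ?in_itv/= ?leey ?andbT ?(ltW p_gt0)//.
  - by apply: integral_ge0 => z _; rewrite lee_fin /h.
  - rewrite EFin_normr_Rintegral//; last exact: (integrableB measurableT if1 if2).
    by apply: le_abse_integral => //; apply/measurable_EFinP; exact: measurable_funB.
apply: (@le_trans _ _ (\int[W]_z ((h z) `^ p)%:E)%E).
  by apply: probability_integral_powR => // z; rewrite /h.
apply: (@le_trans _ _ (\int[W]_z
    (\sum_(i < m) (rho (tnth z i).1 (tnth z i).2 `^ p)%:E))%E).
  apply: ge0_le_integral => //.
  - by move=> z _; rewrite lee_fin powR_ge0.
  - by apply/measurable_EFinP; exact: (measurableT_comp (measurable_powR p)).
  - by apply: emeasurable_sum => i _; exact: mrho.
  - move=> z _; rewrite sumEFin lee_fin (le_trans (lip_powR_le_sum _ _))//.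
    by apply: ler_sum => i _; rewrite !tnth_map.
(* Every coordinate has law [Pi] under [W], so the [m] summands are equal. *)
rewrite ge0_integral_sum//; last by move=> i z _; rewrite lee_fin powR_ge0.
rewrite (eq_bigr (fun=> \int[Pi]_z ((rho z.1 z.2) `^ p)%:E)%E); last first.
  move=> i _; rewrite (@ge0_integral_product_tnth _ _ _ _ _ _ PiW i
    (fun z => ((rho z.1 z.2) `^ p)%:E))//.
  - by apply/measurable_EFinP; exact: (measurableT_comp (measurable_powR p)).
  - by move=> z; rewrite lee_fin powR_ge0.
by rewrite mule_natl sumr_const card_ord.
Qed.

Lemma product_wasserstein_le (mu nu : probability X R)
    (P Q : probability (m.-tuple X) R) : (0 < m)%N ->
  is_product_measure mu P -> is_product_measure nu Q ->
  ((`|\int[P]_x f x - \int[Q]_y f y|)%:E <=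
   (m%:R `^ p^-1)%:E * wasserstein rho p mu nu)%E.
Proof.
move=> m0 muP nuQ; set D := `|_|; rewrite /wasserstein; set S := [set c | _].
have mR0 : 0 < m%:R :> R by rewrite ltr0n.
(* Dividing by [m] first makes the left side a lower bound for all coupling costs; the [p]-th root
   is taken only after the infimum. *)
have : ((D `^ p / m%:R)%:E <= ereal_inf S)%E.
  apply: le_ereal_inf_tmp => _ [Pi [cPi ->]].
  by rewrite EFinM muleC lee_pdivrMl// (product_coupling_le muP nuQ cPi).
move=> DS.
have D0 : 0 <= D `^ p / m%:R by rewrite divr_ge0 ?powR_ge0 ?(ltW mR0).
apply: (@le_trans _ _ ((m%:R `^ p^-1)%:E * (D `^ p / m%:R)%:E `^ p^-1)%E).
  rewrite poweR_EFin -EFinM lee_fin -powRM// ?(ltW mR0)// mulrC divfK ?gt_eqF//.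
  by rewrite -powRrM mulfV ?gt_eqF// powRr1 /D.
apply: lee_wpmul2l; first by rewrite lee_fin powR_ge0.
apply: gt0_ler_poweR => //; rewrite ?in_itv/= ?leey ?andbT ?invr_ge0 ?(ltW p_gt0)//.
by rewrite (le_trans _ DS)// lee_fin.
Qed.

End transport.

Theorem mainTheorem1 (R : realType) (d : measure_display) (X : measurableType d)
    (rho : X -> X -> R) (rho_metric : is_metric rho)
    (X_borel : forall A : set X, measurable A <-> <<s rho_open rho >> A)
    (rho_meas : measurable_fun setT (fun z : X * X => rho z.1 z.2))
    (T : R) (T_gt0 : 0 < T)
    (Dgm : seq X -> seq (R * R))
    (Dgm_diag : forall s, is_diagram T (Dgm s))
    (Dgm_stable : forall s s' : seq X, s != [::] -> s' != [::] ->
        bottleneck (Dgm s) (Dgm s') <= hausdorff rho s s')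
    (p : R) (p_ge1 : 1 <= p) (m : nat) (m_gt0 : (0 < m)%N)
    (Dgm_meas : forall (k : nat) (t : R),
        measurable_fun setT (fun x : m.-tuple X => landscape (Dgm x) k t))
    (mu nu : probability X R)
    (mu_mom : finite_moment rho p mu) (nu_mom : finite_moment rho p nu)
    (Pmu : probability (m.-tuple X) R) (Pnu : probability (m.-tuple X) R)
    (Pmu_prod : is_product_measure mu Pmu) (Pnu_prod : is_product_measure nu Pnu)
    (k : nat) (k_ge1 : (1 <= k)%N) (t : R) :
  ((`| \int[Pmu]_x (landscape (Dgm x) k t) - \int[Pnu]_y (landscape (Dgm y) k t) |)%:E
    <= (m%:R `^ p^-1)%:E * wasserstein rho p mu nu)%E.
Proof.
have [rho_ge0 _ rhoC _] := rho_metric.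
apply: (@product_wasserstein_le _ _ _ _ _ _ rho_ge0 rho_meas p_ge1
  (fun x : m.-tuple X => landscape (Dgm x) k t) T) => //.
- by move=> x; apply: landscape_itv => //; exact: ltW.
- move=> x y c c0 xyc.
  (* Stability is assumed for nonempty samples only; [m_gt0] provides this. *)
  have neq0 (z : m.-tuple X) : z != [::] :> seq X by rewrite -size_eq0 size_tuple -lt0n.
  apply: le_trans (landscape_bottleneck k t (Dgm_diag _) (Dgm_diag _)) _.
  apply: le_trans (Dgm_stable _ _ (neq0 x) (neq0 y)) _.
  by apply: hausdorff_tuple_le => // i; rewrite rhoC.
Qed.
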